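(* Let $R$ be an integrally closed integral domain with fraction field $K$ and fixed separable closure $\bar K$. Let $N\ge1$, let $f\in R[X_1^{\pm1},\ldots,X_N^{\pm1}]$ be non-zero, and for a finite subgroup $\Lambda\subseteq(\bar K^* )^N$ let $W_f(\Lambda)=\prod_{\boldsymbol\zeta\in\Lambda,\ f(\boldsymbol\zeta)\ne0} f(\boldsymbol\zeta)$. Let $\Lambda\subseteq(\bar K^* )^N$ be a finite subgroup. (a) The two expressions \[ V_f(\Lambda):=\prod_{\substack{\boldsymbol\zeta\in(\bar K^* )^N:\ f(\boldsymbol\zeta)\ne0,\\ \langle\boldsymbol\zeta\rangle=\Lambda}} f(\boldsymbol\zeta)\quad\text{and}\quad \prod_{\Lambda'\subseteq\Lambda} W_f(\Lambda')^{\mu(\Lambda,\Lambda')} \] are equal (the latter product over all subgroups $\Lambda'$ of $\Lambda$). In particular, if $\Lambda$ is not cyclic then $V_f(\Lambda)=1$. (b) $V_f(\Lambda)\in R$. (c) $W_f(\Lambda)=\prod_{\Lambda'\subseteq\Lambda} V_f(\Lambda')$ in $R$. (d) If $\boldsymbol\xi\in(\bar K^* )^N$ has order $n$, then \[ V_f(\langle\boldsymbol\xi\rangle)=\prod_{\substack{d\in(\mathbb{Z}/n\mathbb{Z})^*\\ f(\boldsymbol\xi^d)\ne0}} f(\boldsymbol\xi^d)\quad\text{and}\quad W_f(\langle\boldsymbol\xi\rangle)=\prod_{\substack{d\in\mathbb{Z}/n\mathbb{Z}\\ f(\boldsymbol\xi^d)\ne0}} f(\boldsymbol\xi^d). \]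
   Context: $\langle\boldsymbol\zeta\rangle$ is the cyclic subgroup generated by $\boldsymbol\zeta$. The function $\mu$ is the Möbius function of the poset of finite subgroups of $(\bar K^* )^N$ ordered by inclusion, written $\mu(\Lambda,\Lambda')$ for pairs $\Lambda'\subseteq\Lambda$: it is the integer-valued function characterized by $\mu(\Lambda,\Lambda)=1$ and $\sum_{\Lambda_1\subseteq\Lambda'\subseteq\Lambda_2}\mu(\Lambda_2,\Lambda')=0$ whenever $\Lambda_1\subsetneq\Lambda_2$. Empty products equal $1$. *)

(* Defs.v *)
From HB Require Import structures.
From mathcomp Require Import all_boot all_order all_algebra all_field.
From mathcomp Require Import finmap.
From mathcomp Require Import boolp classical_sets functions cardinality fsbigop.
From mathcomp.multinomials Require Import monalg.

Set Implicit Arguments.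
Unset Strict Implicit.
Unset Printing Implicit Defensive.
Import Order.TTheory GRing.Theory Num.Theory.
Local Open Scope classical_set_scope.
Local Open Scope ring_scope.

Notation "\prod_ ( i '\in' A ) F" := (\big[*%R/1%R]_(i \in A) F)
  (at level 34, F at level 36, A at level 60,
   format "'[' \prod_ ( i  '\in'  A ) '/  '  F ']'") : ring_scope.

Section FieldTheory.

Definition integrally_closed (R : idomainType) : Prop :=
  forall x : {fraction R}, integralOver (@tofrac R) x ->
    exists r : R, x = tofrac r.

(* [x] is separable over [K] when it has a separable minimal polynomial; the
   library's [separable_element] only covers finite extensions. *)
Definition separable_over (K L : fieldType) (iota : K -> L) (x : L) : Prop :=
  exists p : {poly K}, [/\ p \is monic, irreducible_poly p, separable_poly p
                         & root (map_poly iota p) x].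

Definition separably_closed (L : fieldType) : Prop :=
  forall p : {poly L}, separable_poly p -> (1 < size p)%N ->
    exists x, root p x.

Definition separable_closure (K L : fieldType) (iota : {rmorphism K -> L}) :
    Prop :=
  (forall x : L, separable_over iota x) /\ separably_closed L.

End FieldTheory.

(* The multiplicative group of a field, as a [groupType]; its powers
   [{ffun I -> mulgroup L}] then carry the product group structure. *)
Record mulgroup (L : fieldType) := MulGroup {
  mulgroup_val :> L;
  mulgroup_neq0 : mulgroup_val != 0 }.
HB.instance Definition _ (L : fieldType) := [isSub for @mulgroup_val L].
HB.instance Definition _ (L : fieldType) := [Choice of mulgroup L by <:].

Section MulGroupStructure.
Variable L : fieldType.
Implicit Types x y z : mulgroup L.

Definition mulgroup_one : mulgroup L := MulGroup (oner_neq0 L).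
Definition mulgroup_mul x y : mulgroup L :=
  MulGroup (mulf_neq0 (mulgroup_neq0 x) (mulgroup_neq0 y)).
Definition mulgroup_inv x : mulgroup L :=
  MulGroup (invr_neq0 (mulgroup_neq0 x)).

Fact mulgroup_mulA : associative mulgroup_mul.
Proof. by move=> x y z; apply/val_inj/mulrA. Qed.
Fact mulgroup_mul1 : left_id mulgroup_one mulgroup_mul.
Proof. by move=> x; apply/val_inj/mul1r. Qed.
Fact mulgroup_mulr1 : right_id mulgroup_one mulgroup_mul.
Proof. by move=> x; apply/val_inj/mulr1. Qed.
Fact mulgroup_mulV : left_inverse mulgroup_one mulgroup_inv mulgroup_mul.
Proof. by move=> x; apply/val_inj/mulVf/mulgroup_neq0. Qed.
Fact mulgroup_mulrV : right_inverse mulgroup_one mulgroup_inv mulgroup_mul.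
Proof. by move=> x; apply/val_inj/mulfV/mulgroup_neq0. Qed.

HB.instance Definition _ := isGroup.Build (mulgroup L)
  mulgroup_mulA mulgroup_mul1 mulgroup_mulr1 mulgroup_mulV mulgroup_mulrV.

End MulGroupStructure.

Notation torus L N := {ffun 'I_N -> mulgroup L}.

Section Subgroups.
Variable G : groupType.
Implicit Types (H A B : set G) (z : G).

Definition is_subgroup H : Prop := group_closed (mem H).

Definition finite_subgroup H : Prop := is_subgroup H /\ finite_set H.

Definition cycle_subgroup z : set G := smallest is_subgroup [set z].

Definition cyclic_subgroup H : Prop := exists z, cycle_subgroup z = H.

Definition has_order z (n : nat) : Prop :=
  [/\ (0 < n)%N, (z ^+ n = 1)%g
    & forall m, (0 < m < n)%N -> (z ^+ m <> 1)%g].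

(* The larger subgroup is the first argument of [mu]. *)
Definition is_moebius (mu : set G -> set G -> int) : Prop :=
  (forall A, finite_subgroup A -> mu A A = 1) /\
  (forall A1 A2, finite_subgroup A1 -> finite_subgroup A2 -> A1 `<` A2 ->
     \sum_(B \in [set B | is_subgroup B /\ A1 `<=` B /\ B `<=` A2])
        mu A2 B = 0).

End Subgroups.

Section MoebiusExists.
Variable G : groupType.
Implicit Types A B : set G.

Fixpoint moebius_rec (n : nat) A2 A1 : int :=
  if A1 == A2 then 1 else
  if n is m.+1 then
    - \sum_(B \in [set B | is_subgroup B /\ A1 `<` B /\ B `<=` A2])
        moebius_rec m A2 B
  else 0.

Let card A := #|` fset_set A|.

Let card_lt A B : finite_set B -> A `<` B -> (card A < card B)%N.
Proof.
move=> fB [AB BA]; have fA := sub_finite_set AB fB.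
apply: fproper_ltn_card; rewrite fproperE; apply/andP; split.
  by apply/fsubsetP => x; rewrite !in_fset_set// !inE; apply: AB.
apply/negP => /fsubsetP BA'; apply: BA => x Bx.
by have := BA' x; rewrite !in_fset_set// !inE; apply.
Qed.

Let properP A B : A `<=` B -> A != B -> A `<` B.
Proof.
by move=> AB nAB; split=> // BA; move/eqP: nAB; apply; apply/seteqP; split.
Qed.

Let moebius_rec_stable n m A2 A1 : finite_set A2 -> A1 `<=` A2 ->
  (card A2 - card A1 <= n)%N -> (card A2 - card A1 <= m)%N ->
  moebius_rec n A2 A1 = moebius_rec m A2 A1.
Proof.
move=> f2; elim: n m A1 => [|n IHn] [|m] A1 s12 len lem //=; case: eqP => // /eqP nA.
- have := card_lt f2 (properP s12 nA).
  by rewrite -subn_gt0; move: len; rewrite leqn0 => /eqP->.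
- have := card_lt f2 (properP s12 nA).
  by rewrite -subn_gt0; move: lem; rewrite leqn0 => /eqP->.
congr (- _); apply: eq_fsbigr => B; rewrite inE => -[_ [lt1B sB2]].
have lt1 := card_lt (sub_finite_set sB2 f2) lt1B.
have lt2 := card_lt f2 (properP s12 nA).
have le_dec k : (card A2 - card A1 <= k.+1)%N -> (card A2 - card B <= k)%N.
  move=> h; rewrite -ltnS; apply: leq_trans h.
  by apply: ltn_sub2l.
by apply: IHn => //; apply: le_dec.
Qed.

Let finite_subsets A : finite_set A -> finite_set [set B | B `<=` A].
Proof.
move=> fA; pose P := fpowerset (fset_set A).
apply: (@sub_finite_set _ _ ((fun X : {fset G} => [set` X]) @` [set` P])).
  move=> B /= BA; have fB := sub_finite_set BA fA.
  exists (fset_set B); last by rewrite fset_setK.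
  by rewrite /= fpowersetE -fset_set_sub.
exact: finite_image (finite_fset _).
Qed.

Lemma is_moebius_exists : exists mu : set G -> set G -> int, is_moebius mu.
Proof.
exists (fun A2 A1 => moebius_rec (card A2) A2 A1); split=> [A _|A1 A2 [g1 f1] [g2 f2] lt12].
  by case: (card A) => [|n] /=; rewrite eqxx.
have [s12 _] := lt12.
have c12 := card_lt f2 lt12.
have fP : finite_set [set B : set G | is_subgroup B /\ A1 `<=` B /\ B `<=` A2].
  apply: sub_finite_set (finite_subsets f2).
  by move=> B [_ [_]].
rewrite (fsbigD1 A1)//=; last by split=> //; split.
have -> : [set B : set G | is_subgroup B /\ A1 `<=` B /\ B `<=` A2] `\ A1 =
          [set B | is_subgroup B /\ A1 `<` B /\ B `<=` A2].
  apply/seteqP; split=> B /=.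
    move=> [[gB [s1B sB2]] neq]; do 2![split=> //].
    by split=> // sB1; apply: neq; apply/seteqP; split.
  move=> [gB [[s1B nB1] sB2]]; split=> // eB.
  by apply: nB1; rewrite eB.
case E: (card A2) c12 => [//|n] c12 /=.
have -> : (A1 == A2) = false.
  by apply/eqP => e12; case: lt12 => _; apply; rewrite e12.
apply/eqP; rewrite addrC subr_eq0; apply/eqP.
apply: eq_fsbigr => B; rewrite inE => -[_ [lt1B sB2]].
have lt1 := card_lt (sub_finite_set sB2 f2) lt1B.
have le : (card A2 - card B <= n)%N.
  by rewrite E leq_subLR -add1n leq_add2r (leq_ltn_trans _ lt1).
by apply: (@moebius_rec_stable n.+1 n) => //; exact: leqW.
Qed.

End MoebiusExists.

(* A Laurent polynomial in [N] variables over [R] is a finitely supported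
   function from the exponents [int ^ N] to [R]: the coefficient of [X ^ e]
   in [f] is [f@_e]. *)
Notation laurent R N := {malg R[{ffun 'I_N -> int}]}.

Section Products.
Variables (R : idomainType) (L : fieldType) (phi : R -> L) (N : nat).
Implicit Types (f : laurent R N) (z : torus L N) (H : set (torus L N)).

Definition leval f z : L :=
  \sum_(e <- msupp f) phi f@_e * \prod_(i < N) (z i : L) ^ e i.

(* [\prod_(x \in A)] equals 1 when infinitely many factors differ from 1, but
   for a finite subgroup [H] all the index sets used here are finite: [z]
   belongs to the subgroup it generates. *)
Definition Wf f H : L :=
  \prod_(z \in [set z | H z /\ leval f z != 0]) leval f z.

Definition Vf f H : L :=
  \prod_(z \in [set z | leval f z != 0 /\ cycle_subgroup z = H]) leval f z.

Definition subgroups_of H : set (set (torus L N)) :=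
  [set H' | is_subgroup H' /\ H' `<=` H].

End Products.

(* Main.v *)
(** The decomposition of [W] into values of [V] sorts the points of the group by
the cyclic subgroup they generate, and Moebius inversion turns it around.  As
the separable closure contains a primitive [n]-th root of unity [z] whenever a
torus point [xi] has order [n] (the characteristic cannot divide [n]), [f(xi^d)]
is [q(z^d)] for one polynomial [q] over [R].  The product of the non-zero
[q(z^d)] runs over the roots of the largest factor of [X^n - 1] over [K] that is
prime to [q], and equals the determinant of [q] at the companion matrix of that
factor; hence [W] of a cyclic group lies in [K].  By induction on the group so
does [V], which is integral over [R], hence in [R]; being a product of values of
[V], [W] of any finite group is in [R] too. *)

Require Import Defs.
From HB Require Import structures.
From mathcomp Require Import all_boot all_order all_algebra all_solvable all_field.
From mathcomp Require Import finmap.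
From mathcomp Require Import boolp classical_sets functions cardinality fsbigop.
From mathcomp.multinomials Require Import monalg.

Set Implicit Arguments.
Unset Strict Implicit.
Unset Printing Implicit Defensive.
Import Order.TTheory GRing.Theory Num.Theory.
Local Open Scope classical_set_scope.
Local Open Scope ring_scope.

(** * Products of the values of a polynomial over roots *)

(* The matrix is the companion matrix of [p], which the Vandermonde matrix of
   the roots of [p] diagonalizes; [companionmx p] would bring in the size
   [(size p).-1]. *)
Lemma det_horner_companion (E : fieldType) (n : nat) (p q : {poly E})
    (a : 'I_n.+1 -> E) :
    p = \prod_i ('X - (a i)%:P) -> injective a ->
  \det (horner_mx (\matrix_(i < n.+1, j < n.+1) (if i == n :> nat then - p`_j
                                   else (i.+1 == j :> nat)%:R)) q) =
  \prod_i q.[a i].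
Proof.
move=> Dp inj_a; set M := \matrix_(i < n.+1, j < n.+1) _.
have sz_p : size p = n.+2.
  by rewrite Dp size_prod_XsubC /index_enum -enumT size_enum_ord.
have mon_p : p \is monic by rewrite Dp monic_prod_XsubC.
pose d : 'rV_n.+1 := \row_i a i; pose U := Vandermonde n.+1 d.
have Uunit : U \is a GRing.unit.
  rewrite -[_ \is a _]/(U \in unitmx) unitmxE det_Vandermonde unitfE.
  apply/prodf_neq0 => i _; apply/prodf_neq0 => j lt_ij.
  by rewrite !mxE subr_eq0 (inj_eq inj_a) -val_eqE /= gtn_eqF.
(* Column [j] of [U] lists the powers of [a j]: the upper rows of [M] shift them, and the last row
   reduces the power [n.+1] by means of [p.[a j] = 0]. *)
have MU : M *m U = U *m diag_mx d.
  apply/matrixP=> i j; rewrite mul_mx_diag !mxE -exprSr.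
  have [ei|ni] := eqVneq (i : nat) n.
    have: root p (a j) by rewrite Dp rootE horner_prod (bigD1 j) //= hornerXsubC subrr mul0r.
    rewrite rootE horner_coef sz_p big_ord_recr /=.
    have -> : p`_n.+1 = 1 by move/monicP: mon_p; rewrite lead_coefE sz_p.
    rewrite mul1r addrC addr_eq0 ei => /eqP ->; rewrite -sumrN.
    by apply: eq_bigr => k _; rewrite !mxE ei eqxx mulNr.
  have lt_in : (i.+1 < n.+1)%N by rewrite ltnS ltn_neqAle ni -ltnS ltn_ord.
  rewrite (bigD1 (Ordinal lt_in)) //= !mxE (negPf ni) eqxx mul1r big1 ?addr0 // => k.
  by rewrite -val_eqE /= !mxE (negPf ni) eq_sym => /negPf->; rewrite mul0r.
have -> : M = U *m diag_mx d *m invmx U by rewrite -MU mulmxK.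
rewrite horner_mx_uconj // horner_mx_diag !det_mulmx mulrAC -det_mulmx mulmxV //.
by rewrite det1 mul1r det_diag; apply: eq_bigr => i _; rewrite !mxE.
Qed.

(** The companion matrix of [p], made monic, has entries in [F], so the determinant that computes
    the product is already in [F]. Asking for the factorization only up to a scalar lets [p] come
    from a gcd computation. *)
Lemma prod_horner_roots (F E : fieldType) (f : {rmorphism F -> E}) (p q : {poly F})
    (rs : seq E) :
    uniq rs -> map_poly f p %= \prod_(x <- rs) ('X - x%:P) ->
  exists c, f c = \prod_(x <- rs) (map_poly f q).[x].
Proof.
(* The companion matrix has size [n.+1], so the empty list is treated apart. *)
case Drs: rs => [|x0 rs'] uniq_rs Dp; first by exists 1; rewrite big_nil rmorph1.
pose n := size rs'; pose a (i : 'I_n.+1) := nth 0 rs i.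
have Ea (R : Type) (idx : R) op (F0 : E -> R) :
    \big[op/idx]_(x <- rs) F0 x = \big[op/idx]_(i < n.+1) F0 (a i).
  by rewrite /a (big_nth 0) big_mkord Drs.
have inj_a : injective a.
  by move=> i j /eqP; rewrite /a Drs nth_uniq // => /eqP/val_inj.
pose r := (lead_coef p)^-1 *: p.
have p_neq0 : p != 0.
  apply: contraTneq Dp => ->; rewrite rmorph0 eqp_sym eqp0.
  by rewrite monic_neq0 ?monic_prod_XsubC.
have Dr : map_poly f r = \prod_i ('X - (a i)%:P).
  apply/eqP; rewrite -(Ea _ _ _ (fun x => 'X - x%:P)) -eqp_monic ?monic_prod_XsubC //.
    rewrite Drs; apply: eqp_trans Dp; rewrite map_polyZ eqp_scale //.
    by rewrite fmorph_eq0 invr_eq0 lead_coef_eq0.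
  by rewrite map_monic monicE lead_coefZ mulVf ?lead_coef_eq0.
exists (\det (horner_mx (\matrix_(i < n.+1, j < n.+1)
  (if i == n :> nat then - r`_j else (i.+1 == j :> nat)%:R)) q)).
rewrite -det_map_mx map_horner_mx -Drs Ea -(det_horner_companion _ Dr inj_a).
congr (\det (horner_mx _ _)); apply/matrixP=> i j; rewrite !mxE coef_map.
by case: ifP; rewrite ?rmorphN ?rmorph_nat.
Qed.

Lemma prod_horner_unity_roots (F E : fieldType) (f : {rmorphism F -> E})
    (q : {poly F}) (n : nat) (z : E) : n.-primitive_root z ->
  exists c, f c = \prod_(d < n | (map_poly f q).[z ^+ d] != 0) (map_poly f q).[z ^+ d].
Proof.
move=> prim_z; have n_gt0 := prim_order_gt0 prim_z.
set qE := map_poly f q; pose rs := [seq z ^+ d | d : 'I_n <- index_enum 'I_n].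
have uniq_rs : uniq rs.
  rewrite map_inj_in_uniq ?index_enum_uniq // => i j _ _ /eqP.
  by rewrite (eq_prim_root_expr prim_z) !modn_small // => /eqP/val_inj.
have Xn1 : 'X^n - 1 = \prod_(x <- rs) ('X - x%:P).
  by rewrite -(factor_Xn_sub_1 prim_z) big_mkord big_map.
have Xn1_neq0 (R : idomainType) : ('X^n - 1 : {poly R}) != 0.
  by rewrite monic_neq0 ?monic_Xn_sub_1.
(* The largest divisor of ['X^n - 1] coprime to [q]: it is defined over [F] and its formation
   commutes with [f], while its roots in [E] are the [z ^+ d] at which [q] does not vanish. *)
pose p := gdcop q ('X^n - 1).
have Dp : map_poly f p = gdcop qE ('X^n - 1).
  by rewrite gdcop_map rmorphB rmorph1 /= map_polyXn.
have [m] : {m | map_poly f p %= \prod_(x <- mask m rs) ('X - x%:P)}.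
  by apply: dvdp_prod_XsubC; rewrite -Xn1 Dp dvdp_gdco.
set ms := mask m rs => Dms.
have uniq_ms : uniq ms by rewrite mask_uniq.
have Ems : perm_eq ms [seq x <- rs | qE.[x] != 0].
  apply: uniq_perm => // [|x]; first exact: filter_uniq.
  rewrite -root_prod_XsubC -(eqp_root Dms) Dp root_gdco // mem_filter andbC.
  by rewrite Xn1 root_prod_XsubC.
have [c Dc] := prod_horner_roots q uniq_ms Dms; exists c.
by rewrite Dc (perm_big _ Ems) big_filter big_map.
Qed.

(** * Roots of unity in a separably closed field *)

Lemma separably_closed_splits (E : fieldType) (p : {poly E}) :
  separably_closed E -> separable_poly p ->
  exists rs, p %= \prod_(x <- rs) ('X - x%:P).
Proof.
move=> Ecl; have [n] := ubnP (size p); elim: n p => // n IHn p lt_pn sep_p.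
have [sz_p|sz_p] := leqP (size p) 1.
  exists [::]; rewrite big_nil -size_poly_eq1 eqn_leq sz_p.
  by rewrite size_poly_gt0 separable_poly_neq0.
have [x /factor_theorem[q Dp]] := Ecl p sep_p sz_p.
have q_neq0 : q != 0.
  by apply: contraTneq sz_p => q0; rewrite Dp q0 mul0r size_poly0.
have [] := IHn q.
- by move: lt_pn; rewrite Dp size_Mmonic ?monicXsubC // size_XsubC addn2.
- by move: sep_p; rewrite Dp separable_mul => /and3P[].
by move=> rs Drs; exists (x :: rs); rewrite Dp big_cons mulrC eqp_mull.
Qed.

(** As [n] is invertible, ['X^n - 1] is separable and so has [n] distinct roots; so many [n]-th
    roots of unity must include a primitive one. *)
Lemma separably_closed_prim_root (E : fieldType) (n : nat) :
  separably_closed E -> n%:R != 0 :> E -> exists z : E, n.-primitive_root z.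
Proof.
move=> Ecl nE; have n_gt0 : (0 < n)%N by case: n nE; rewrite ?eqxx.
have sep := separable_Xn_sub_1 nE.
have [rs] := separably_closed_splits Ecl sep.
have mon := monic_Xn_sub_1 E n_gt0.
rewrite eqp_monic ?monic_prod_XsubC // => /eqP Drs.
have uniq_rs : uniq rs by rewrite -separable_prod_XsubC -Drs.
have sz_rs : (n <= size rs)%N.
  by rewrite -ltnS -(size_prod_XsubC _ id) -Drs size_Xn_sub_1.
have rs1 : all n.-unity_root rs.
  by apply/allP=> x; rewrite unity_rootE -root_prod_XsubC -Drs rootE !hornerE subr_eq0.
by have /hasP[z _ prim_z] := has_prim_root n_gt0 rs1 uniq_rs sz_rs; exists z.
Qed.

(** * Element orders and cyclic subgroups *)

Section CyclicSubgroups.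
Variable G : groupType.
Implicit Types (H : set G) (x y : G).

Lemma subgroup1 H : is_subgroup H -> H 1%g.
Proof. by case=> H1 _; apply: set_mem. Qed.

Lemma subgroupM H x y : is_subgroup H -> H x -> H y -> H (x * y)%g.
Proof.
by move=> gH Hx Hy; apply: set_mem; apply: (group_closedM gH); apply: mem_set.
Qed.

Lemma subgroupX H x n : is_subgroup H -> H x -> H (x ^+ n)%g.
Proof.
move=> gH Hx; elim: n => [|n IHn]; first exact: subgroup1.
by rewrite expgS; apply: subgroupM.
Qed.

Lemma cycle_subgroupP x : is_subgroup (cycle_subgroup x).
Proof.
split=> [|y z /set_mem xy /set_mem xz]; apply: mem_set => H /= [gH sxH].
  exact: subgroup1.
by apply: set_mem; apply: gH.2; apply: mem_set; [apply: xy|apply: xz].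
Qed.

Lemma mem_cycle_subgroup x : cycle_subgroup x x.
Proof. by move=> H [_]; apply. Qed.
Arguments mem_cycle_subgroup : clear implicits.

Lemma cycle_subgroup_sub H x : is_subgroup H -> H x -> cycle_subgroup x `<=` H.
Proof. by move=> gH Hx; apply: smallest_sub => // y ->. Qed.

Lemma has_orderX x n a : has_order x n -> (x ^+ (a %% n) = x ^+ a)%g.
Proof.
case=> _ xn1 _; rewrite [in RHS](divn_eq a n) expgnDr mulnC expgnA xn1.
by rewrite expg1n mul1g.
Qed.

Lemma has_order_eq x n a b :
  has_order x n -> (x ^+ a = x ^+ b)%g -> (a = b %[mod n])%N.
Proof.
move=> ox; wlog le_ba : a b / (b %% n <= a %% n)%N => [IH|].
  by case: (leqP (b %% n) (a %% n)) => [/IH //|/ltnW /IH {}IH /esym/IH/esym].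
rewrite -(has_orderX a ox) -(has_orderX b ox) => eab.
case: ox => n_gt0 _ minn; apply/eqP; rewrite eqn_leq le_ba andbT leqNgt.
(* If the residues differed, their difference would be a positive exponent below the order that
   kills [x]. *)
apply/negP=> lt_ba; apply: (minn (a %% n - b %% n)%N).
  by rewrite subn_gt0 lt_ba (leq_ltn_trans (leq_subr _ _)) ?ltn_mod.
by rewrite expgnFr // eab mulgV.
Qed.

Lemma has_order_exists H x : finite_subgroup H -> H x -> exists n, has_order x n.
Proof.
move=> [gH fH] Hx; have ex_n : exists n, (0 < n)%N && (x ^+ n == 1)%g.
  (* Without a trivial positive power, [n |-> x ^+ n] would embed the natural numbers into the
     finite set [H]. *)
  apply: contrapT => no_n; apply: infinite_nat.
  apply: (@sub_finite_set _ _ ((fun n => x ^+ n)%g @^-1` H)).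
    by move=> n _; apply: subgroupX.
  apply: finite_preimage fH => a b _ _.
  wlog lt_ab : a b / (a < b)%N => [IH|].
    by case: (ltngtP a b) => // [/IH //|/IH {}IH /esym/IH].
  move=> eab; case: no_n; exists (b - a)%N.
  by rewrite subn_gt0 lt_ab expgnFr ?(ltnW lt_ab) // eab mulgV /=.
have [n /andP[n_gt0 /eqP xn1] minn] := ex_minnP ex_n.
exists n; split=> // m /andP[m_gt0 lt_mn] xm1.
by move: lt_mn; rewrite ltnNge minn // m_gt0 xm1 /=.
Qed.

Lemma mem_cycle_subgroupX x a : cycle_subgroup x (x ^+ a)%g.
Proof. exact: subgroupX a (cycle_subgroupP x) (mem_cycle_subgroup x). Qed.
Arguments mem_cycle_subgroupX : clear implicits.

Lemma cycle_subgroupE x n :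
  has_order x n -> cycle_subgroup x = [set (x ^+ d)%g | d in `I_n].
Proof.
move=> ox; have [n_gt0 xn1 _] := ox.
have X_in a : [set (x ^+ d)%g | d in `I_n] (x ^+ a)%g.
  by exists (a %% n)%N; [rewrite /= ltn_mod|apply: has_orderX].
apply/seteqP; split=> [|_ [d _ <-]]; last exact: mem_cycle_subgroupX.
apply: cycle_subgroup_sub; last by rewrite -[x in X in _ X]expg1.
split=> [|_ _ /set_mem[a _ <-] /set_mem[b /= ltbn <-]]; apply: mem_set.
  exact: (X_in 0%N).
(* Since [x ^+ n = 1], the inverse of [x ^+ b] is the power [n - b]. *)
suff -> : (x ^+ a / x ^+ b = x ^+ (a + (n - b)))%g by [].
by rewrite expgnDr expgnFr ?(ltnW ltbn) // xn1 mul1g.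
Qed.

Lemma finite_cycle_subgroup x n : has_order x n -> finite_subgroup (cycle_subgroup x).
Proof.
move=> ox; split; first exact: cycle_subgroupP.
by rewrite (cycle_subgroupE ox); apply/finite_image/finite_II.
Qed.

Lemma cycle_subgroupX x n d :
  has_order x n -> cycle_subgroup (x ^+ d)%g = cycle_subgroup x <-> coprime d n.
Proof.
move=> ox; have [n_gt0 _ _] := ox.
split=> [eq_dx|co_dn].
  have [m od] := has_order_exists (finite_cycle_subgroup ox) (mem_cycle_subgroupX x d).
  have := mem_cycle_subgroup x; rewrite -eq_dx (cycle_subgroupE od) => -[k _].
  rewrite -expgnA -[in RHS](expg1 x) => /(has_order_eq ox) dk1.
  (* Writing [x] as a power [k] of [x ^+ d] makes [k] an inverse of [d] modulo [n]. *)
  suff: coprime (d * k) n by rewrite coprimeMl => /andP[].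
  by rewrite -coprime_modl dk1 coprime_modl coprime1n.
apply/seteqP; split.
  exact: cycle_subgroup_sub (cycle_subgroupP x) (mem_cycle_subgroupX x d).
apply: cycle_subgroup_sub (cycle_subgroupP _) _.
(* By Euler's theorem [d ^ (totient n).-1] inverts [d] modulo [n], so this power of [x ^+ d] is [x]
   itself. *)
have := mem_cycle_subgroupX (x ^+ d)%g (d ^ (totient n).-1).
rewrite -expgnA -expnS prednK ?totient_gt0 // -(has_orderX (d ^ totient n) ox).
by rewrite Euler_exp_totient // (has_orderX _ ox) expg1.
Qed.

Lemma finite_subgroups_of H : finite_set H ->
  finite_set [set H' | is_subgroup H' /\ H' `<=` H].
Proof.
move=> fH; apply: (@sub_finite_set _ _
  ((fun X : {fset G} => [set` X]) @` [set` fpowerset (fset_set H)])).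
  move=> B [_ BH] /=; have fB := sub_finite_set BH fH.
  by exists (fset_set B); rewrite ?fset_setK // /= fpowersetE -fset_set_sub.
exact/finite_image/finite_fset.
Qed.

End CyclicSubgroups.

Arguments mem_cycle_subgroup {G} x.
Arguments mem_cycle_subgroupX {G} x a.

(** * Finitely supported products *)

Section FiniteSupportProducts.

(** No finiteness of [A] is asked: with infinite support the product defaults to [idx], which
    satisfies [K]. *)
Lemma fsbig_closed (T : Type) (idx : T) (op : T -> T -> T) (K : T -> Prop)
    (I : choiceType) (A : set I) (F : I -> T) :
    K idx -> (forall a b, K a -> K b -> K (op a b)) ->
    (forall i, A i -> K (F i)) -> K (\big[op/idx]_(i \in A) F i).
Proof.
move=> K1 KM KF; case: finite_supportP => [_|X XA _ _]; rewrite ?big_nil //.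
by rewrite big_seq_cond; apply: big_ind => // i /andP[/XA/KF].
Qed.

Lemma fsbig_fibers (T : eqType) (idx : T) (op : Monoid.com_law idx)
    (I J : choiceType) (h : I -> J) (A : set I) (B : set J) (F : I -> T) :
    finite_set A -> finite_set B -> (forall i, A i -> B (h i)) ->
  \big[op/idx]_(i \in A) F i =
  \big[op/idx]_(j \in B) \big[op/idx]_(i \in A `&` [set i | h i = j]) F i.
Proof.
move=> fA fB hAB; under [in RHS]eq_fsbigr do rewrite fsbig_mkcondr.
(* After the exchange, the inner product for a fixed [i] has [j = h i] as its only index with a
   possibly non-trivial factor. *)
rewrite exchange_fsbig //; apply: eq_fsbigr => i /set_mem Ai.
rewrite (fsbigD1 (h i)) ?ifT ?inE //=; last exact: hAB.
rewrite fsbig1 ?Monoid.mulm1 // => j [_ /=]; rewrite /mkset => nij.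
by rewrite ifF //; apply/negP; rewrite inE => /esym.
Qed.

Lemma expfz_fsprod (F : fieldType) (I : choiceType) (A : set I) (E : I -> F) m :
  finite_set A -> (\prod_(i \in A) E i) ^ m = \prod_(i \in A) E i ^ m.
Proof.
move=> fA; rewrite !fsbig_finite //.
by apply: (big_morph (fun x => x ^ m)) => [x y|]; rewrite ?expfzMl ?exp1rz.
Qed.

Lemma expfz_fssum (F : fieldType) (I : choiceType) (A : set I) (x : F) (m : I -> int) :
  finite_set A -> x != 0 -> x ^ (\sum_(i \in A) m i) = \prod_(i \in A) x ^ m i.
Proof.
move=> fA x0; rewrite !fsbig_finite //.
by apply: (big_morph (fun m => x ^ m)) => // a b; rewrite expfzDr.
Qed.

Lemma fsbig_cycle (T : Type) (idx : T) (op : Monoid.com_law idx) (G : groupType)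
    (x : G) (n : nat) (P : pred nat) (F : G -> T) : has_order x n ->
  \big[op/idx]_(z \in [set (x ^+ d)%g | d in `I_n `&` [set` P]]) F z =
  \big[op/idx]_(d < n | P d) F (x ^+ d)%g.
Proof.
move=> ox; rewrite fsbig_image; last first.
  move=> a b /set_mem[/= lt_an _] /set_mem[/= lt_bn _] /(has_order_eq ox).
  by rewrite !modn_small.
rewrite fsbig_mkcondr -fsbig_ord.
by rewrite [RHS]big_mkcond; apply: eq_bigr => d _; rewrite mem_setE.
Qed.

End FiniteSupportProducts.

(** * Laurent polynomials at torsion points of the torus *)

Section LaurentEvaluation.
Variables (R : idomainType) (E : fieldType) (phi : {rmorphism R -> E}) (N : nat).
Implicit Types (f : laurent R N) (xi : torus E N).

Lemma torusX xi d i : ((xi ^+ d)%g i : E) = (xi i : E) ^+ d.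
Proof.
elim: d => [|d IHd]; first by rewrite expg0 ffunE.
by rewrite expgS ffunE /= exprS -IHd.
Qed.

(* In characteristic p the group of p-th roots of unity is trivial. *)
Lemma has_order_torus_natr_neq0 xi n : has_order xi n -> n%:R != 0 :> E.
Proof.
move=> [n_gt0 xin1 minn]; apply/negP=> n0.
have [p charp] := natf0_pchar n_gt0 n0.
have p_pr := pcharf_prime charp.
have /dvdnP[m Dn] : (p %| n)%N by rewrite (dvdn_pcharf charp).
have m_gt0 : (0 < m)%N by move: n_gt0; rewrite Dn muln_gt0 => /andP[].
(* With [n = m * p], the Frobenius sends each coordinate of [xi ^+ m] to 1; being injective, it
   forces [xi ^+ m = 1], although [m < n]. *)
apply: (minn m); first by rewrite m_gt0 Dn ltn_Pmulr ?prime_gt1.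
apply/ffunP=> i; apply/val_inj; rewrite /= torusX ffunE /=.
apply: (fmorph_inj (pFrobenius_aut charp)).
rewrite rmorph1; apply: etrans (pFrobenius_autE charp _) _.
by rewrite -exprM -Dn -torusX xin1 ffunE.
Qed.

(* Each monomial takes an [n]-th root of unity, hence a power of [z], as its
   value at [xi]. *)
Lemma leval_cycle f xi n (z : E) : has_order xi n -> n.-primitive_root z ->
  exists q : {poly R}, forall d, leval phi f (xi ^+ d)%g = (map_poly phi q).[z ^+ d].
Proof.
move=> [_ xin1 _] prim_z.
have monomial_unity (e : {ffun 'I_N -> int}) :
    (\prod_(i < N) (xi i : E) ^ e i) ^+ n = 1.
  rewrite -prodrXl big1 // => i _.
  by rewrite exprnP exprzAC -exprnP -torusX xin1 ffunE exp1rz.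
(* [b e] is the discrete logarithm to base [z] of the monomial value at [xi]; being a natural number
   even when [e] has negative entries, it yields a genuine polynomial. *)
pose b e := sval (prim_rootP prim_z (monomial_unity e)).
exists (\sum_(e <- msupp f) f@_e *: 'X^(b e)) => d.
rewrite /leval rmorph_sum horner_sum; apply: eq_bigr => e _ /=.
rewrite map_polyZ map_polyXn !hornerE; congr (_ * _).
rewrite -exprM mulnC exprM -(svalP (prim_rootP prim_z (monomial_unity e))).
by rewrite -prodrXl; apply: eq_bigr => i _; rewrite torusX !exprnP exprzAC.
Qed.

(** The value is a polynomial over [R] in a root of unity, which is integral. *)
Lemma integral_leval f xi n : separably_closed E -> has_order xi n ->
  integralOver phi (leval phi f xi).
Proof.
move=> Ecl oxi; have n_gt0 : (0 < n)%N by case: oxi.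
have [z prim_z] := separably_closed_prim_root Ecl (has_order_torus_natr_neq0 oxi).
have [q Dq] := leval_cycle f oxi prim_z.
rewrite -(expg1 xi) Dq expr1; apply: integral_horner.
  by apply/integral_poly => i; rewrite coef_map; apply: integral_id.
exists ('X^n - 1); first exact: monic_Xn_sub_1.
by rewrite rmorphB rmorph1 /= map_polyXn rootE !hornerE (prim_expr_order prim_z) subrr.
Qed.

End LaurentEvaluation.

(** * Decomposition by cyclic subgroups and Moebius inversion *)

Section CyclicDecomposition.
Variables (R : idomainType) (E : fieldType) (phi : R -> E) (N : nat) (f : laurent R N).
Implicit Types (H Lam : set (torus E N)).

(** Needed for negative exponents in the inversion and for division in the descent to the base
    field. *)
Lemma Vf_neq0 H : Vf phi f H != 0.
Proof.
by apply: (fsbig_closed (K := fun x => x != 0)) => [|x y|z []];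
  [exact: oner_neq0|exact: mulf_neq0|].
Qed.

(** The fibre of [z |-> cycle_subgroup z] over [H] consists of exactly the points whose values make
    up [Vf phi f H]. *)
Lemma Wf_prod_Vf Lam : finite_subgroup Lam ->
  Wf phi f Lam = \prod_(H \in subgroups_of Lam) Vf phi f H.
Proof.
move=> [gL fL]; have fS : finite_set (subgroups_of Lam) := finite_subgroups_of fL.
rewrite /Wf (fsbig_fibers (h := fun z : torus E N => cycle_subgroup z) _ _ _ fS);
  first last.
- by move=> z [Lz _]; split; [exact: cycle_subgroupP|exact: cycle_subgroup_sub].
- by apply: sub_finite_set fL => z [].
apply: eq_fsbigr => H /set_mem[_ HL]; apply: eq_fsbigl; apply/seteqP; split=> z /=.
  by case=> [[_ evz] Dz].
move=> [evz Dz]; do 2![split=> //]; apply: HL.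
by rewrite -Dz; apply: mem_cycle_subgroup.
Qed.

Lemma Vf_moebius (mu : set (torus E N) -> set (torus E N) -> int) Lam :
    is_moebius mu -> finite_subgroup Lam ->
  Vf phi f Lam = \prod_(H \in subgroups_of Lam) Wf phi f H ^ mu Lam H.
Proof.
move=> [mu1 mu0] [gL fL].
have fS : finite_set (subgroups_of Lam) := finite_subgroups_of fL.
have fin_sub H : subgroups_of Lam H -> finite_subgroup H.
  by move=> [gH HL]; split=> //; apply: sub_finite_set fL.
transitivity (\prod_(H \in subgroups_of Lam) \prod_(J \in subgroups_of Lam)
    (if H \in [set H | J `<=` H] then Vf phi f J ^ mu Lam H else 1)); last first.
  apply: eq_fsbigr => H /set_mem SH; rewrite (Wf_prod_Vf (fin_sub H SH)).
  rewrite expfz_fsprod; last exact/finite_subgroups_of/(fin_sub H SH).2.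
  have -> : subgroups_of H = subgroups_of Lam `&` [set J | J `<=` H].
    case: SH => gH HL; apply/seteqP; split=> J /=; last by case=> [[? ?] ?].
    by move=> [gJ JH]; do 2![split=> //]; apply: subset_trans HL.
  by rewrite [RHS]fsbig_mkcondr; apply: eq_fsbigr => J _.
rewrite exchange_fsbig //.
(* The exponent of [Vf phi f J] is now the sum of [mu Lam H] over [H] between [J] and [Lam]: 1 for
   [J = Lam] and 0 otherwise. *)
transitivity (\prod_(J \in subgroups_of Lam)
    Vf phi f J ^ \sum_(H \in subgroups_of Lam `&` [set H | J `<=` H]) mu Lam H);
  last first.
  apply: eq_fsbigr => J _; rewrite -fsbig_mkcondr expfz_fssum ?Vf_neq0 //.
  exact: finite_setIl.
have SLam : subgroups_of Lam Lam by split.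
rewrite (fsbigD1 Lam) // -[LHS]mulr1.
congr (_ * _); last apply/esym/fsbig1 => J [[gJ JL] nJ]; last first.
  rewrite (_ : _ `&` _ = [set B | is_subgroup B /\ J `<=` B /\ B `<=` Lam]).
    rewrite mu0 //; first exact: fin_sub.
    by split=> // LJ; apply: nJ; apply/seteqP.
  by apply/seteqP; split=> B /= [] => [[? ?]|? []].
rewrite (_ : _ `&` _ = [set Lam]) ?fsbig_set1 ?mu1 //.
apply/seteqP; split=> B /=; first by move=> [[_ BL] LB]; apply/seteqP.
by move=> ->; split.
Qed.

Lemma Vf_noncyclic H : ~ cyclic_subgroup H -> Vf phi f H = 1.
Proof. by move=> ncH; apply: fsbig1 => z [_ Dz]; case: ncH; exists z. Qed.

Lemma Wf_cycle (xi : torus E N) n : has_order xi n ->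
  Wf phi f (cycle_subgroup xi) =
    \prod_(d < n | leval phi f (xi ^+ d)%g != 0) leval phi f (xi ^+ d)%g.
Proof.
move=> oxi.
rewrite -(fsbig_cycle _ (fun d => leval phi f (xi ^+ d)%g != 0) (leval phi f) oxi).
apply: eq_fsbigl; rewrite (cycle_subgroupE oxi); apply/seteqP; split=> z /=.
  by move=> [[d /= ltd <-] evd]; exists d.
by move=> [d [/= ltd evd] <-]; split=> //; exists d.
Qed.

Lemma Vf_cycle (xi : torus E N) n : has_order xi n ->
  Vf phi f (cycle_subgroup xi) =
    \prod_(d < n | coprime d n && (leval phi f (xi ^+ d)%g != 0))
      leval phi f (xi ^+ d)%g.
Proof.
move=> oxi.
rewrite -(fsbig_cycle _ (fun d => coprime d n && (leval phi f (xi ^+ d)%g != 0))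
  (leval phi f) oxi).
apply: eq_fsbigl; apply/seteqP; split=> z /=.
  move=> [evz Dz]; have := mem_cycle_subgroup z; rewrite Dz (cycle_subgroupE oxi).
  move=> [d /= ltd Dd]; exists d => //; split=> //; apply/andP.
  by split; [apply: (iffLR (cycle_subgroupX d oxi))|]; rewrite Dd.
move=> [d [/= _ /andP[co_d evd]] <-]; split=> //.
exact: (iffRL (cycle_subgroupX d oxi)).
Qed.

End CyclicDecomposition.

(** * Descent to the base field and integrality *)

Section Integrality.
Variables (R : idomainType) (F E : fieldType).
Variables (psi : {rmorphism R -> F}) (iota : {rmorphism F -> E}).
Variables (N : nat) (f : laurent R N).
Hypothesis Ecl : separably_closed E.
Let phi : {rmorphism R -> E} := iota \o psi.

Lemma Wf_cycle_rational (xi : torus E N) n : has_order xi n ->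
  exists c, iota c = Wf phi f (cycle_subgroup xi).
Proof.
move=> oxi; rewrite (Wf_cycle phi f oxi).
have [z prim_z] := separably_closed_prim_root Ecl (has_order_torus_natr_neq0 oxi).
have [q Dq] := leval_cycle phi f oxi prim_z.
have [c Dc] := prod_horner_unity_roots iota (map_poly psi q) prim_z.
by exists c; rewrite Dc; apply: eq_big => d; rewrite Dq map_poly_comp.
Qed.

(** Strong induction on the cardinality: for cyclic [Lam], dividing [Wf] by the product of [Vf] over
    the proper subgroups leaves [Vf phi f Lam]. *)
Lemma Vf_rational Lam : finite_subgroup Lam -> exists c, iota c = Vf phi f Lam.
Proof.
have [n] := ubnP #|` fset_set Lam|; elim: n Lam => // n IHn Lam lt_n [gL fL].
have [[xi Dxi]|/(Vf_noncyclic phi f) ->] := pselect (cyclic_subgroup Lam); last first.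
  by exists 1; rewrite rmorph1.
have [m oxi] := has_order_exists (conj gL fL)
  (eq_ind _ (fun H : set _ => H xi) (mem_cycle_subgroup xi) _ Dxi).
have [c Dc] := Wf_cycle_rational oxi; rewrite Dxi in Dc.
have [c' Dc'] : exists c', iota c' = \prod_(H \in subgroups_of Lam `\ Lam) Vf phi f H.
  apply: (fsbig_closed (K := fun x => exists c, iota c = x)).
  - by exists 1; rewrite rmorph1.
  - by move=> _ _ [a <-] [b <-]; exists (a * b); rewrite rmorphM.
  move=> H [[gH HL] nH]; have fH := sub_finite_set HL fL.
  apply: IHn => //; rewrite -ltnS; apply: leq_trans lt_n; rewrite ltnS.
  apply: fproper_ltn_card; rewrite fproperEneq; apply/andP; split.
    by apply/eqP => /(fset_set_inj fH fL).
  by rewrite -fset_set_sub.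
have fS : finite_set (subgroups_of Lam) := finite_subgroups_of fL.
have WE : Wf phi f Lam =
    Vf phi f Lam * \prod_(H \in subgroups_of Lam `\ Lam) Vf phi f H.
  rewrite (Wf_prod_Vf phi f (conj gL fL)).
  by rewrite (fsbigD1 Lam _ _ fS (conj gL (@subset_refl _ Lam))).
exists (c / c'); rewrite fmorph_div Dc Dc' WE mulfK //.
by apply: (fsbig_closed (K := fun x => x != 0)) => [|x y|H _];
  [exact: oner_neq0|exact: mulf_neq0|exact: Vf_neq0].
Qed.

Lemma integral_Vf Lam : finite_subgroup Lam -> integralOver phi (Vf phi f Lam).
Proof.
move=> fL; apply: fsbig_closed => [||z [_ Dz]].
- exact: integral1.
- by move=> x y; apply: integral_mul.
have Lz : Lam z by rewrite -Dz; apply: mem_cycle_subgroup.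
by have [n oz] := has_order_exists fL Lz; apply: integral_leval oz.
Qed.

Lemma Vf_integral_rational Lam : finite_subgroup Lam ->
  exists2 c, iota c = Vf phi f Lam & integralOver psi c.
Proof.
move=> fL; have [c Dc] := Vf_rational fL; exists c => //.
(* The same monic polynomial over [R] serves for [c], because [iota] is injective. *)
have [p mon_p] := integral_Vf fL; exists p => //.
by rewrite -(fmorph_root iota) -map_poly_comp Dc.
Qed.

End Integrality.

Theorem theorem3p1 (R : idomainType) (Rclosed : integrally_closed R)
  (Kbar : fieldType) (iota : {rmorphism {fraction R} -> Kbar})
  (Kbar_sepcl : separable_closure iota)
  (N : nat) (N_gt0 : (0 < N)%N) (f : laurent R N) (f_neq0 : f != 0)
  (mu : set (torus Kbar N) -> set (torus Kbar N) -> int)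
  (mu_moebius : is_moebius mu) :
  let phi : R -> Kbar := fun r => iota (tofrac r) in
  let ev := leval phi f in
  let W := Wf phi f in
  let V := Vf phi f in
  (forall Lam : set (torus Kbar N), finite_subgroup Lam ->
    [/\ V Lam = \prod_(H \in subgroups_of Lam) W H ^ mu Lam H,
        ~ cyclic_subgroup Lam -> V Lam = 1,
        (exists r : R, phi r = V Lam),
        (exists r : R, phi r = W Lam)
      & W Lam = \prod_(H \in subgroups_of Lam) V H])
  /\
  (forall (xi : torus Kbar N) (n : nat), has_order xi n ->
    V (cycle_subgroup xi) =
      \prod_(d < n | coprime d n && (ev (xi ^+ d)%g != 0)) ev (xi ^+ d)%g
    /\
    W (cycle_subgroup xi) =
      \prod_(d < n | ev (xi ^+ d)%g != 0) ev (xi ^+ d)%g).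
Proof.
move=> phi ev W V; have [_ Kcl] := Kbar_sepcl.
have V_in_R Lam : finite_subgroup Lam -> exists r, phi r = V Lam.
  move=> fL; have [c Dc /Rclosed[r Dr]] := Vf_integral_rational (@tofrac R) iota f Kcl fL.
  by exists r; rewrite /phi -Dr.
split=> [Lam fL|xi n oxi]; last by split; [exact: Vf_cycle|exact: Wf_cycle].
split; [exact: Vf_moebius|exact: Vf_noncyclic|exact: V_in_R| |exact: Wf_prod_Vf].
(* The descent of [Wf] was obtained for cyclic groups only; for arbitrary [Lam], membership in [R]
   is inherited from the factors [V H]. *)
rewrite /W (Wf_prod_Vf phi f fL).
apply: (fsbig_closed (K := fun x => exists r, phi r = x)).
- by exists 1; rewrite /phi !rmorph1.
- by move=> _ _ [a <-] [b <-]; exists (a * b); rewrite /phi !rmorphM.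
by move=> H [gH HL]; apply: V_in_R; split=> //; apply: sub_finite_set HL fL.2.
Qed.
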